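(* Let $P_m(A)=\sum_{k=0}^{m}p_kA^k$ be a matrix polynomial of degree $m$, with scalar coefficients $p_k\in\mathbb{C}$ and $A\in\mathbb{C}^{n\times n}$. Assume that the algebraic system defining the $6s$ evaluation scheme (described in the context) admits numerically stable solutions. For an integer parameter $s\ge 3$ and $m=6s+q$ with $q\ge 0$ an integer, $P_m(A)$ can be evaluated using the hybrid Paterson--Stockmeyer configuration $Z_{2qs}(A)$ (defined in the context), yielding a total computational cost, counted in matrix-matrix multiplications, of $$C_{Z_{2qs}}(m)=s+2+\left\lceil \frac{q}{s}\right\rceil .$$ Furthermore, for every degree $m\in\{18,21,24,26,27,28\}$ and every $m\ge 30$, there exists a parameter combination $(s,q)$ (with $s\ge 3$, $q\ge 0$, $m=6s+q$) such that $$C_{Z_{2qs}}(m)=C_{PS}(m)-2,$$ where $C_{PS}(m)$ is the cost of the optimal Paterson--Stockmeyer method; that is, exactly two matrix-matrix multiplications are saved compared to the optimal Paterson--Stockmeyer method.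
   Context: Cost model: the cost of an evaluation scheme is its number of matrix-matrix multiplications; matrix additions and multiplications by scalars are not counted. Powers of $A$ that have been computed are stored and may be reused. Paterson--Stockmeyer (PS) cost: the standard cost of the PS method for a matrix polynomial of degree $m$ is $C_{PS}(m)=\sigma+\lceil m/\sigma\rceil-2$, where the splitting parameter $\sigma$ is the optimal integer value, which is either $\lfloor\sqrt m\rfloor$ or $\lceil\sqrt m\rceil$; i.e. $C_{PS}(m)=\min_{\sigma\in\{\lfloor\sqrt m\rfloor,\lceil\sqrt m\rceil\}}(\sigma+\lceil m/\sigma\rceil-2)$. The $6s$ evaluation scheme: given scalars $c_0,c_1,\dots,c_{6s}$, after computing the powers $A^2,\dots,A^s$, set $$Y_0=A^s\sum_{i=1}^{s}c_{5s+i}A^i,$$ let $Y_1$ be given by one of the three alternatives $$Y_1=\Big(Y_0+\sum_{i=1}^{s}c_{4s+i}A^i\Big)\Big(Y_0+\sum_{i=2}^{s}c_{3s+i}A^i\Big)+c_{3s+1}Y_0+\sum_{i=1}^{s}c_{2s+i}A^i,$$ $$Y_1=\Big(Y_0+\sum_{i=0}^{s}c_{4s+i}A^i\Big)\Big(Y_0+\sum_{i=2}^{s}c_{3s+i-1}A^i\Big)+\sum_{i=1}^{s}c_{2s+i}A^i,$$ $$Y_1=\Big(Y_0+\sum_{i=1}^{s}c_{4s+i}A^i\Big)\Big(Y_0+\sum_{i=1}^{s}c_{3s+i}A^i\Big)+\sum_{i=1}^{s}c_{2s+i}A^i,$$ and set $$Y_2=Y_1\Big(Y_0+\sum_{i=1}^{s}c_{s+i}A^i\Big)+\sum_{i=0}^{s}c_iA^i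 .$$ Formally, $Y_2=\sum_{k=0}^{6s}y_{2_k}A^k$, where each $y_{2_k}$ is a polynomial expression in $c_0,\dots,c_{6s}$. The algebraic system defining the $6s$ scheme for a target polynomial $\sum_{k=0}^{6s}b_kA^k$ with $b_{6s}\ne 0$ is the system $y_{2_k}=b_k$, $k=0,\dots,6s$, in the unknowns $c_0,\dots,c_{6s}$. When the scheme is used for $P_m$ with $m=6s+q$, the target coefficients are $b_k=p_{q+k}$, $k=0,\dots,6s$ (the leading coefficient $b_{6s}=p_m$ being nonzero). Numerical stability of a solution: a solution $c_0,\dots,c_{6s}$ is called numerically stable if, when it is rounded to the working floating-point precision with unit roundoff $u$ (e.g. $u=2^{-53}$ in IEEE double precision, $u=2^{-24}$ in IEEE single precision) and the coefficients $y_{2_k}$ are reconstructed from the rounded values, the error $\epsilon=\max_{0\le k\le 6s}\epsilon_k$, with $\epsilon_k=|b_k-y_{2_k}|/|b_k|$ if $b_k\ne0$ and $\epsilon_k=|b_k-y_{2_k}|$ if $b_k=0$, is of the order of $u$. Hybrid configuration: for $m=6s+q$, put $t=\lfloor q/s\rfloor$ and $r=q\bmod s$, so $0\le r<s$. With $Y_2=\sum_{k=0}^{6s}p_{q+k}A^k$ evaluated by the $6s$ scheme, $$Z_{2qs}(A)=\Big(\cdots\Big(\Big(Y_2A^s+\sum_{i=1}^{s}p_{q-i}A^{s-i}\Big)A^s+\sum_{i=1}^{s}p_{q-s-i}A^{s-i}\Big)A^s+\cdots+\sum_{i=1}^{s}p_{q-(t-1)s-i}A^{s-i}\Big)A^r+\sum_{j=0}^{r-1}p_jA^j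 ,$$ where there are $t$ successive multiplications by $A^s$ (none if $t=0$), and the final multiplication by $A^r$ is omitted when $r=0$. $C_{Z_{2qs}}(m)$ denotes the number of matrix-matrix multiplications used to evaluate $Z_{2qs}(A)$, including the computation of the powers $A^2,\dots,A^s$. *)

(* Defs.v *)
From Stdlib Require PeanoNat.
From HB Require Import structures.
From mathcomp Require Import all_boot all_order all_algebra.
From mathcomp Require Import reals complex.

Set Implicit Arguments.
Unset Strict Implicit.
Unset Printing Implicit Defensive.

Import Order.TTheory GRing.Theory Num.Theory.
Local Open Scope ring_scope.

Definition ceil_div (a b : nat) : nat := (a %/ b + ~~ (b %| a))%N.

(* For m > 0 no truncation occurs, as both summands are then positive. *)
Definition PS_cost_at (m sigma : nat) : nat :=
  (sigma + ceil_div m sigma - 2)%N.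

(* Nat.sqrt and Nat.sqrt_up are the floor and the ceiling of the square root. *)
Definition C_PS (m : nat) : nat :=
  minn (PS_cost_at m (PeanoNat.Nat.sqrt m))
       (PS_cost_at m (PeanoNat.Nat.sqrt_up m)).

(** * The formulas, over an arbitrary algebra

    They are used both for square matrices and, to make sense of "the formal
    coefficients of Y2", for the indeterminate 'X of {poly F}.  The unknowns
    are given as c : nat -> F, of which only c 0, ..., c (6 * s) occur. *)

Inductive Y1_form := Y1_first | Y1_second | Y1_third.

Definition comb (F : fieldType) (T : lalgType F) (A : T) (a b : nat)
    (f : nat -> F) : T :=
  \sum_(a <= i < b.+1) f i *: A ^+ i.

Definition Y0 (F : fieldType) (T : lalgType F) (s : nat) (c : nat -> F)
    (A : T) : T :=
  A ^+ s * comb A 1 s (fun i => c (5 * s + i)%N).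

Definition Y1 (F : fieldType) (T : lalgType F) (alt : Y1_form) (s : nat)
    (c : nat -> F) (A : T) : T :=
  match alt with
  | Y1_first =>
      (Y0 s c A + comb A 1 s (fun i => c (4 * s + i)%N))
        * (Y0 s c A + comb A 2 s (fun i => c (3 * s + i)%N))
      + c (3 * s + 1)%N *: Y0 s c A + comb A 1 s (fun i => c (2 * s + i)%N)
  | Y1_second =>
      (Y0 s c A + comb A 0 s (fun i => c (4 * s + i)%N))
        * (Y0 s c A + comb A 2 s (fun i => c (3 * s + i - 1)%N))
      + comb A 1 s (fun i => c (2 * s + i)%N)
  | Y1_third =>
      (Y0 s c A + comb A 1 s (fun i => c (4 * s + i)%N))
        * (Y0 s c A + comb A 1 s (fun i => c (3 * s + i)%N))
      + comb A 1 s (fun i => c (2 * s + i)%N)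
  end.

Definition Y2 (F : fieldType) (T : lalgType F) (alt : Y1_form) (s : nat)
    (c : nat -> F) (A : T) : T :=
  Y1 alt s c A * (Y0 s c A + comb A 1 s (fun i => c (s + i)%N))
  + comb A 0 s c.

Definition y2 (F : fieldType) (alt : Y1_form) (s : nat) (c : nat -> F)
    (k : nat) : F :=
  (Y2 alt s c 'X : {poly F})`_k.

Definition is_solution (F : fieldType) (alt : Y1_form) (s : nat)
    (b c : nat -> F) : Prop :=
  forall k : nat, (k <= 6 * s)%N -> y2 alt s c k = b k.

(* The parenthesised part of Z after t multiplications by A ^+ s. *)
Fixpoint Z_blocks (F : fieldType) (T : lalgType F) (s q : nat) (p : {poly F})
    (A Y : T) (t : nat) : T :=
  if t is t'.+1 then
    Z_blocks s q p A Y t' * A ^+ s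
    + \sum_(1 <= i < s.+1) p`_(q - t' * s - i) *: A ^+ (s - i)
  else Y.

Definition Z2qs (F : fieldType) (T : lalgType F) (alt : Y1_form) (s q : nat)
    (c : nat -> F) (p : {poly F}) (A : T) : T :=
  Z_blocks s q p A (Y2 alt s c A) (q %/ s) * A ^+ (q %% s)
  + \sum_(0 <= j < q %% s) p`_j *: A ^+ j.

(** * Cost model

    A program is a sequence of multiplications whose operands, like the final
    result, are linear combinations of values obtained before; only the
    multiplications are charged.  Programs are written for an arbitrary type V
    of values, so that V offers no operation besides those of the model. *)

Definition lincomb (F V : Type) := seq (F * V).

Inductive prog (F V : Type) :=
| Return of lincomb F V
| Multiply of lincomb F V & lincomb F V & (V -> prog F V).

Arguments Return {F V}.
Arguments Multiply {F V}.

Fixpoint multiplications (F : Type) (P : prog F unit) : nat :=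
  match P with
  | Return _ => 0
  | Multiply _ _ k => (multiplications (k tt)).+1
  end.

Definition lincomb_value (F : fieldType) (T : lalgType F) (l : lincomb F T) : T :=
  \sum_(x <- l) x.1 *: x.2.

Fixpoint run (F : fieldType) (T : lalgType F) (P : prog F T) : T :=
  match P with
  | Return l => lincomb_value l
  | Multiply l1 l2 k => run (k (lincomb_value l1 * lincomb_value l2))
  end.

(** * The program evaluating Z

    The stored powers are pw = [:: I; A; A^2; ...; A^s], where the identity I
    and A itself are free. *)

Fixpoint powers_prog (F : fieldType) (V : Type) (I A : V) (pw : seq V)
    (n : nat) (k : seq V -> prog F V) : prog F V :=
  if n is n'.+1 then
    Multiply [:: (1, last I pw)] [:: (1, A)]
      (fun B => powers_prog I A (rcons pw B) n' k)
  else k pw.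

Definition comb_prog (F V : Type) (I : V) (pw : seq V) (a b : nat)
    (f : nat -> F) : lincomb F V :=
  [seq (f i, nth I pw i) | i <- index_iota a b.+1].

Definition Y2_prog (F : fieldType) (V : Type) (alt : Y1_form) (s : nat)
    (c : nat -> F) (I : V) (pw : seq V) (k : lincomb F V -> prog F V)
    : prog F V :=
  let cb := comb_prog I pw in
  Multiply [:: (1, nth I pw s)] (cb 1%N s (fun i => c (5 * s + i)%N)) (fun y0 =>
  let Y1_left :=
    match alt with
    | Y1_first => (1, y0) :: cb 1%N s (fun i => c (4 * s + i)%N)
    | Y1_second => (1, y0) :: cb 0%N s (fun i => c (4 * s + i)%N)
    | Y1_third => (1, y0) :: cb 1%N s (fun i => c (4 * s + i)%N)
    end in
  let Y1_right :=
    match alt with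
    | Y1_first => (1, y0) :: cb 2%N s (fun i => c (3 * s + i)%N)
    | Y1_second => (1, y0) :: cb 2%N s (fun i => c (3 * s + i - 1)%N)
    | Y1_third => (1, y0) :: cb 1%N s (fun i => c (3 * s + i)%N)
    end in
  let Y1_rest :=
    match alt with
    | Y1_first =>
        (c (3 * s + 1)%N, y0) :: cb 1%N s (fun i => c (2 * s + i)%N)
    | Y1_second | Y1_third => cb 1%N s (fun i => c (2 * s + i)%N)
    end in
  Multiply Y1_left Y1_right (fun w1 =>
  Multiply ((1, w1) :: Y1_rest) ((1, y0) :: cb 1%N s (fun i => c (s + i)%N))
    (fun w2 => k ((1, w2) :: cb 0%N s c)))).

(* Y is the value after j multiplications by A ^+ s; n of them remain. *)
Fixpoint blocks_prog (F : fieldType) (V : Type) (s q : nat) (p : {poly F})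
    (I : V) (pw : seq V) (n j : nat) (Y : lincomb F V)
    (k : lincomb F V -> prog F V) : prog F V :=
  if n is n'.+1 then
    Multiply Y [:: (1, nth I pw s)] (fun w =>
      blocks_prog s q p I pw n' j.+1
        ((1, w) :: [seq (p`_(q - j * s - i), nth I pw (s - i))
                   | i <- index_iota 1 s.+1]) k)
  else k Y.

Definition Z2qs_prog (F : fieldType) (alt : Y1_form) (s q : nat)
    (c : nat -> F) (p : {poly F}) (V : Type) (I A : V) : prog F V :=
  powers_prog I A [:: I; A] s.-1 (fun pw =>
  Y2_prog alt s c I pw (fun y =>
  blocks_prog s q p I pw (q %/ s) 0 y (fun z =>
  if (q %% s)%N == 0%N then Return z
  else Multiply z [:: (1, nth I pw (q %% s))] (fun w =>
       Return ((1, w) :: [seq (p`_j, nth I pw j)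
                         | j <- index_iota 0 (q %% s)]))))).

Definition C_Z2qs (F : fieldType) (alt : Y1_form) (s q : nat)
    (c : nat -> F) (p : {poly F}) : nat :=
  multiplications (Z2qs_prog alt s q c p tt tt).

(** * Floating point and numerical stability

    Radix beta, prec digits, unbounded exponent range (as usual in rounding
    error analysis).  IEEE double precision is beta = 2, prec = 53, for which
    the unit roundoff is 2 ^- 53; single precision is beta = 2, prec = 24. *)

Definition is_float (R : realType) (beta prec : nat) (x : R) : Prop :=
  exists M e : int, (`|M| < beta ^ prec)%N /\ x = M%:~R * beta%:R ^ e.

(* No tie-breaking rule is imposed. *)
Definition rounds_to_nearest (R : realType) (beta prec : nat) (fl : R -> R)
    : Prop :=
  forall x : R, is_float beta prec (fl x) /\
    forall y : R, is_float beta prec y -> `|x - fl x| <= `|x - y|.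

Definition unit_roundoff (R : realType) (beta prec : nat) : R :=
  beta%:R ^- prec.-1 / 2%:R.

Definition round_complex (R : realType) (fl : R -> R) (z : R[i]) : R[i] :=
  let: Complex x y := z in Complex (fl x) (fl y).

Definition coef_error (R : realType) (b y : R[i]) : R :=
  if b != 0 then ComplexField.Normc.normc (b - y) / ComplexField.Normc.normc b
  else ComplexField.Normc.normc (b - y).

Definition reconstruction_error (R : realType) (fl : R -> R) (alt : Y1_form)
    (s : nat) (b c : nat -> R[i]) : R :=
  \big[Num.max/0]_(k < (6 * s).+1)
    coef_error (b k) (y2 alt s (fun i => round_complex fl (c i)) k).

(* "Of the order of the unit roundoff u" reads "at most K * u", for a constant
   K left as a parameter. *)
Definition stable_solution (R : realType) (beta prec : nat) (fl : R -> R)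
    (K : R) (alt : Y1_form) (s : nat) (b c : nat -> R[i]) : Prop :=
  is_solution alt s b c /\
  reconstruction_error fl alt s b c <= K * unit_roundoff R beta prec.

(* Main.v *)
Require Import Defs.
From mathcomp Require Import all_boot all_order all_algebra.
From mathcomp Require Import reals complex.
From mathcomp Require Import zify.

Set Implicit Arguments.
Unset Strict Implicit.
Unset Printing Implicit Defensive.

Import Order.TTheory GRing.Theory Num.Theory.
Local Open Scope ring_scope.

(** Correctness is an identity of polynomials in one indeterminate.  A solution
    [c] of the system prescribes the coefficients of [Y2] at ['X] up to degree
    [6 * s], and [Y2] has no coefficient beyond (its factors have degrees
    [4 * s] and [2 * s], see [size_Y2]), so [Y2] at ['X] is [drop_poly q p], the
    quotient of [p] by ['X^q].  Each multiplication by ['X^s], like the last one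
    by ['X^(q %% s)], is a Horner step restoring the next lower coefficients of
    [p]; at the end [Z2qs] at ['X] is [p] ([Z2qs_solution]).  All the formulas
    are built from algebra operations, hence commute with the evaluation
    morphism [horner_mx A] ([rmorph_Z2qs]), which yields the matrix statement.
    Every solution works, so the stable one that is supposed to exist is kept
    unchanged.

    The program multiplies [s - 1] times for the powers, three times for [Y0],
    [Y1] and [Y2], and then once per block and once more if [s] does not divide
    [q]; the last two contributions add up to the ceiling of [q / s]
    ([C_Z2qsE]).

    For [m = 6 * s + q] this cost is [s + 2 + ceil (m / s) - 6], two less than
    the Paterson--Stockmeyer cost with splitting parameter the same [s]
    ([two_saved]).  It thus suffices that some optimal splitting parameter
    be at most [m / 6].  The floor [k] of the square root of [m] is always
    optimal ([C_PS_floor]), and [6 * k <= m] as soon as [30 <= m]: either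
    [6 <= k] and [6 * k <= k ^ 2 <= m], or [k = 5].  For the six smaller degrees
    the value [3] or [4] attains the Paterson--Stockmeyer cost. *)

(** * The Paterson--Stockmeyer cost *)

Lemma ceil_div_leq (a b n : nat) :
  (0 < b)%N -> (ceil_div a b <= n)%N = (a <= n * b)%N.
Proof.
move=> b_gt0; rewrite /ceil_div /dvdn.
have := divn_eq a b; have := ltn_pmod a b_gt0.
case: eqP => /= [->|] *; apply/idP/idP => ?; nia.
Qed.

Lemma ceil_divMDr (a b n : nat) :
  (0 < b)%N -> ceil_div (n * b + a) b = (n + ceil_div a b)%N.
Proof.
by move=> b_gt0; rewrite /ceil_div divnMDl// dvdn_addr ?dvdn_mull// addnA.
Qed.

(** Write [k] for the floor of the square root.  Going from [k] to [k.+1] raises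
    the first summand by one, so the claim is [ceil (m / k) <= d + 1] for
    [d = ceil (m / k.+1)], that is [m <= k * (d + 1)].  If [d <= k], then
    [m <= d * k.+1 = k * d + d] suffices; otherwise [m <= k * (k + 2)] does,
    which is the definition of [k]. *)
Lemma C_PS_floor (m : nat) : (0 < m)%N ->
  C_PS m = PS_cost_at m (PeanoNat.Nat.sqrt m).
Proof.
move=> m_gt0; apply/minn_idPl; rewrite /PS_cost_at.
set k := PeanoNat.Nat.sqrt m.
have [klo khi] := PeanoNat.Nat.sqrt_spec m (PeanoNat.Nat.le_0_l m).
have k_gt0 : (0 < k)%N by rewrite /k; nia.
have [->//|->] : PeanoNat.Nat.sqrt_up m = k \/ PeanoNat.Nat.sqrt_up m = k.+1.
  have := PeanoNat.Nat.le_sqrt_sqrt_up m.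
  have := PeanoNat.Nat.le_sqrt_up_succ_sqrt m.
  rewrite /k; lia.
apply: leq_sub2r; rewrite addSnnS leq_add2l ceil_div_leq//.
set d := ceil_div m k.+1.
have : (m <= d * k.+1)%N by rewrite -ceil_div_leq.
case: (leqP d k) => ? ?; rewrite -/k in klo khi; nia.
Qed.

(** Since [6 * s] is a multiple of [s], the ceiling of [q / s] is that of [m / s]
    minus six; the scheme pays four multiplications for these six. *)
Lemma two_saved (m s : nat) : (0 < s)%N -> (6 * s <= m)%N ->
  (s + 2 + ceil_div (m - 6 * s) s + 2)%N = PS_cost_at m s.
Proof.
move=> s_gt0 s_le.
by rewrite /PS_cost_at -{2}(subnKC s_le) ceil_divMDr//; lia.
Qed.

(** * Number of multiplications of the program *)

Section Cost.
Variable F : fieldType.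

(** Programs are in continuation-passing style, so the count of a part is stated
    relative to a continuation whose own count [N] does not depend on the values
    passed to it. *)
Lemma multiplications_powers (pw : seq unit) (n N : nat)
    (k : seq unit -> prog F unit) :
  (forall pw, multiplications (k pw) = N) ->
  multiplications (powers_prog tt tt pw n k) = (n + N)%N.
Proof. by move=> kN; elim: n pw => //= n IHn pw; rewrite IHn. Qed.

Lemma multiplications_blocks (s q : nat) (p : {poly F}) (pw : seq unit)
    (n j N : nat) (Y : lincomb F unit) (k : lincomb F unit -> prog F unit) :
  (forall Y, multiplications (k Y) = N) ->
  multiplications (blocks_prog s q p tt pw n j Y k) = (n + N)%N.
Proof. by move=> kN; elim: n j Y => //= n IHn j Y; rewrite IHn. Qed.

Lemma C_Z2qsE (alt : Y1_form) (s q : nat) (c : nat -> F) (p : {poly F}) :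
  (0 < s)%N -> C_Z2qs alt s q c p = (s + 2 + ceil_div q s)%N.
Proof.
move=> s_gt0; rewrite /C_Z2qs /Z2qs_prog.
rewrite (@multiplications_powers _ _ (3 + ceil_div q s)) => [|pw]; first lia.
rewrite /= (@multiplications_blocks _ _ _ _ _ _ (~~ (s %| q)%N))//=.
by move=> Y; rewrite /dvdn; case: eqP.
Qed.

End Cost.

(** * The program computes the formula *)

Section Run.
Variables (F : fieldType) (T : lalgType F) (A : T).

Lemma run_powers (j n : nat) (k : seq T -> prog F T) :
  run (powers_prog 1 A (mkseq (GRing.exp A) j.+1) n k)
  = run (k (mkseq (GRing.exp A) (j + n).+1)).
Proof.
elim: n j => [|n IHn] j; first by rewrite addn0.
rewrite -addSnnS -IHn (mkseqS _ j.+1).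
have : last 1 (mkseq (GRing.exp A) j.+1) = A ^+ j.
  by rewrite mkseqS last_rcons.
move: (mkseq _ _) => pw /= last_pw.
by rewrite /lincomb_value !big_seq1 /= !scale1r last_pw -exprSr.
Qed.

Variable s : nat.
Let pw := mkseq (GRing.exp A) s.+1.

Lemma lincomb_value_cons (a : F) (v : T) (l : lincomb F T) :
  lincomb_value ((a, v) :: l) = a *: v + lincomb_value l.
Proof. exact: big_cons. Qed.

Lemma lincomb_value_power (i : nat) :
  (i <= s)%N -> lincomb_value [:: (1, nth 1 pw i)] = A ^+ i :> T.
Proof. by move=> ?; rewrite /lincomb_value big_seq1 /= scale1r nth_mkseq. Qed.

Lemma lincomb_value_powers (a b : nat) (f : nat -> F) (g : nat -> nat) :
  (forall i, (a <= i < b)%N -> g i <= s)%N ->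
  lincomb_value [seq (f i, nth 1 pw (g i)) | i <- index_iota a b]
  = \sum_(a <= i < b) f i *: A ^+ g i :> T.
Proof.
move=> g_le; rewrite /lincomb_value big_map; apply: eq_big_nat => i /g_le ?.
by rewrite /= nth_mkseq.
Qed.

Lemma lincomb_value_comb (a : nat) (f : nat -> F) :
  lincomb_value (comb_prog 1 pw a s f) = comb A a s f.
Proof. by apply: lincomb_value_powers => i /andP[]. Qed.

(** The program hands its continuation a linear combination rather than a value:
    the last addition is left pending and costs nothing.  Only the value of that
    combination matters afterwards, whence the existential form, shared with
    [run_blocks]. *)
Lemma run_Y2 (alt : Y1_form) (c : nat -> F) (k : lincomb F T -> prog F T) :
  exists2 l, lincomb_value l = Y2 alt s c A
    & run (Y2_prog alt s c 1 pw k) = run (k l).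
Proof.
rewrite /Y2_prog /= lincomb_value_power// lincomb_value_comb -/(Y0 s c A).
eexists; last reflexivity.
rewrite lincomb_value_cons scale1r lincomb_value_comb /Y2; congr (_ * _ + _).
  by case: alt; rewrite !(lincomb_value_comb, lincomb_value_cons) ?scale1r ?addrA.
by rewrite lincomb_value_cons scale1r lincomb_value_comb.
Qed.

Lemma run_blocks (q : nat) (p : {poly F}) (Y : T) (n j : nat)
    (l : lincomb F T) (k : lincomb F T -> prog F T) :
  lincomb_value l = Z_blocks s q p A Y j ->
  exists2 l', lincomb_value l' = Z_blocks s q p A Y (j + n)
    & run (blocks_prog s q p 1 pw n j l k) = run (k l').
Proof.
elim: n j l => [|n IHn] j l lE /=; first by exists l; rewrite ?addn0.
rewrite -addSnnS; apply: IHn.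
rewrite lincomb_value_cons scale1r lE lincomb_value_power//=.
by congr (_ + _); apply: lincomb_value_powers => i _; apply: leq_subr.
Qed.

End Run.

Lemma run_Z2qs (F : fieldType) (T : lalgType F) (alt : Y1_form) (s q : nat)
    (c : nat -> F) (p : {poly F}) (A : T) :
  (0 < s)%N -> run (Z2qs_prog alt s q c p 1 A) = Z2qs alt s q c p A.
Proof.
move=> s_gt0; rewrite /Z2qs_prog.
(* [:: 1; A] and the list of the first two powers of A are convertible. *)
rewrite -[[:: 1; A]]/(mkseq (GRing.exp A) 2) run_powers add1n prednK//.
set k2 := (X in Y2_prog _ _ _ _ _ X).
have [l lE ->] := run_Y2 A s alt c k2; rewrite {}/k2.
set k3 := (X in blocks_prog _ _ _ _ _ _ _ _ X).
have [l' l'E ->] := @run_blocks _ _ A s q p _ (q %/ s) 0 l k3 lE.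
rewrite {}/k3 /Z2qs -l'E; have [->|_] := eqVneq.
  (* For a zero remainder, the formula multiplies by A ^+ 0 and adds nothing. *)
  by rewrite big_geq// addr0 expr0 mulr1.
have r_lt := ltn_pmod q s_gt0.
rewrite /= lincomb_value_cons scale1r lincomb_value_power 1?ltnW//.
congr (_ + _); apply: lincomb_value_powers => i /andP[_ i_lt].
exact: leq_trans (ltnW i_lt) (ltnW r_lt).
Qed.

(** * The formulas commute with algebra morphisms *)

Section Morphism.
Variables (F : fieldType) (T U : lalgType F) (f : {lrmorphism T -> U}).

Lemma rmorph_comb (A : T) (a b : nat) (g : nat -> F) :
  f (comb A a b g) = comb (f A) a b g.
Proof. by rewrite rmorph_sum; apply: eq_bigr => i _; rewrite /= linearZ rmorphXn. Qed.

Lemma rmorph_Y0 (s : nat) (c : nat -> F) (A : T) :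
  f (Y0 s c A) = Y0 s c (f A).
Proof. by rewrite rmorphM rmorphXn /= rmorph_comb. Qed.

Lemma rmorph_Y2 (alt : Y1_form) (s : nat) (c : nat -> F) (A : T) :
  f (Y2 alt s c A) = Y2 alt s c (f A).
Proof.
rewrite rmorphD rmorphM rmorphD /= !rmorph_comb rmorph_Y0; congr (_ * _ + _).
by case: alt; rewrite /= !rmorphD rmorphM !rmorphD /= ?linearZ /= !rmorph_comb rmorph_Y0.
Qed.

Lemma rmorph_Z2qs (alt : Y1_form) (s q : nat) (c : nat -> F) (p : {poly F})
    (A : T) :
  f (Z2qs alt s q c p A) = Z2qs alt s q c p (f A).
Proof.
have fsum (a b : nat) (g : nat -> F) (h : nat -> nat) :
    f (\sum_(a <= i < b) g i *: A ^+ h i) = \sum_(a <= i < b) g i *: f A ^+ h i.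
  by rewrite rmorph_sum; apply: eq_bigr => i _; rewrite /= linearZ rmorphXn.
rewrite rmorphD rmorphM rmorphXn /= fsum; congr (_ * _ + _).
elim: (q %/ s)%N => [|t IHt] /=; first exact: rmorph_Y2.
by rewrite rmorphD rmorphM rmorphXn /= IHt fsum.
Qed.

End Morphism.

(** * The formulas at the indeterminate *)

Section Polynomial.
Variable F : fieldType.
Implicit Types (p : {poly F}) (c : nat -> F).

Let size_mul_bound (a b : nat) (u v : {poly F}) :
  (size u <= a.+1)%N -> (size v <= b.+1)%N -> (size (u * v)%R <= (a + b).+1)%N.
Proof. by move=> ? ?; apply: leq_trans (size_polyMleq _ _) _; lia. Qed.

Let size_add_bound (a : nat) (u v : {poly F}) :
  (size u <= a)%N -> (size v <= a)%N -> (size (u + v)%R <= a)%N.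
Proof. by move=> ? ?; rewrite (leq_trans (size_polyD _ _))// geq_max; apply/andP. Qed.

Lemma size_comb (a s n : nat) (f : nat -> F) :
  (s <= n)%N -> (size (comb ('X : {poly F}) a s f) <= n.+1)%N.
Proof.
move=> s_le; rewrite /comb big_nat_cond.
apply: (big_ind (fun u : {poly F} => size u <= n.+1)%N).
- by rewrite size_poly0.
- exact: size_add_bound.
- move=> i /andP[/andP[_ i_le] _].
  by rewrite (leq_trans (size_scale_leq _ _))// size_polyXn; lia.
Qed.

Lemma size_Y0 (s : nat) c : (size (Y0 s c ('X : {poly F})) <= (2 * s).+1)%N.
Proof. by rewrite mul2n -addnn size_mul_bound ?size_polyXn ?size_comb. Qed.

(** The system only constrains the coefficients of degree at most [6 * s]; this
    bound is what turns a solution of it into an equality of polynomials. *)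
Lemma size_Y2 (alt : Y1_form) (s : nat) c :
  (size (Y2 alt s c ('X : {poly F})) <= (6 * s).+1)%N.
Proof.
have factor_size a (f : nat -> F) :
    (size (Y0 s c 'X + comb 'X a s f)%R <= (2 * s).+1)%N.
  by rewrite size_add_bound ?size_Y0 ?size_comb//; lia.
have Y1_size : (size (Y1 alt s c ('X : {poly F})) <= (4 * s).+1)%N.
  have -> : (4 * s = 2 * s + 2 * s)%N by lia.
  case: alt => /=; apply: size_add_bound; rewrite ?size_mul_bound ?size_comb//;
    try lia.
  apply: size_add_bound; first exact: size_mul_bound.
  rewrite (leq_trans (size_scale_leq _ _))// (leq_trans (size_Y0 _ _))//; lia.
have -> : (6 * s = 4 * s + 2 * s)%N by lia.
by rewrite size_add_bound ?size_mul_bound ?size_comb//; lia.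
Qed.

(** One Horner step in base ['X^s]: the sum, indexed by decreasing degree, is the
    remainder of [drop_poly n p] modulo ['X^s]. *)
Lemma drop_poly_block (n s : nat) p :
  drop_poly n p = drop_poly (n + s) p * 'X^s
    + \sum_(1 <= i < s.+1) p`_(n + s - i) *: 'X^(s - i).
Proof.
have -> : drop_poly (n + s) p = drop_poly s (drop_poly n p).
  by apply/polyP => i; rewrite !coef_drop_poly addnAC addnA.
rewrite -[LHS](poly_take_drop s) addrC.
congr (_ + _); rewrite [take_poly _ _]poly_def.
rewrite big_add1 big_nat_rev big_mkord; apply: eq_bigr => i _.
by rewrite coef_drop_poly add0n subnSK// -addnBA ?leq_subr// subKn 1?ltnW// addnC.
Qed.

(** The hypothesis keeps the natural subtractions in the indices of [p] from
    being truncated. *)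
Lemma Z_blocks_drop_poly (s q t : nat) p :
  (t * s <= q)%N ->
  Z_blocks s q p 'X (drop_poly q p) t = drop_poly (q - t * s) p.
Proof.
elim: t => [|t IHt] ts_le /=; first by rewrite subn0.
rewrite IHt; last by rewrite (leq_trans _ ts_le)// mulSn leq_addl.
rewrite [RHS](drop_poly_block _ s).
by have -> : (q - t.+1 * s + s = q - t * s)%N by rewrite mulSn in ts_le *; lia.
Qed.

Lemma Z2qs_solution (alt : Y1_form) (s q : nat) p c :
  (0 < s)%N -> (size p <= (6 * s + q).+1)%N ->
  is_solution alt s (fun k => p`_(q + k)) c ->
  Z2qs alt s q c p 'X = p.
Proof.
move=> s_gt0 p_size c_sol.
have Y2E : Y2 alt s c 'X = drop_poly q p.
  apply/polyP => k; rewrite coef_drop_poly addnC.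
  (* Beyond degree 6 * s both coefficients vanish. *)
  have [k_le|k_gt] := leqP k (6 * s); first exact: c_sol.
  rewrite [RHS]nth_default; last by rewrite (leq_trans p_size)//; lia.
  by rewrite nth_default// (leq_trans (size_Y2 _ _ _)).
rewrite /Z2qs Y2E Z_blocks_drop_poly ?leq_trunc_div//.
have -> : (q - q %/ s * s = q %% s)%N by rewrite {1}(divn_eq q s) addKn.
rewrite addrC -[RHS](poly_take_drop (q %% s)); congr (_ + _).
by rewrite [take_poly _ _]poly_def big_mkord.
Qed.

End Polynomial.

Theorem theorem2p1 (R : realType) (beta prec : nat) (fl : R -> R) (K : R)
    (hbeta : (1 < beta)%N) (hprec : (0 < prec)%N)
    (hfl : rounds_to_nearest beta prec fl) :
  (forall (alt : Y1_form) (s q : nat) (p : {poly R[i]}),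
     (3 <= s)%N ->
     size p = (6 * s + q).+1 ->
     (exists c : nat -> R[i],
        stable_solution beta prec fl K alt s (fun k => p`_(q + k)) c) ->
     exists c : nat -> R[i],
       [/\ stable_solution beta prec fl K alt s (fun k => p`_(q + k)) c,
           forall (n : nat) (A : 'M[R[i]]_n.+1),
             Z2qs alt s q c p A = horner_mx A p /\
             run (Z2qs_prog alt s q c p 1 A) = Z2qs alt s q c p A
         & C_Z2qs alt s q c p = (s + 2 + ceil_div q s)%N])
  /\
  (forall m : nat, (m \in [:: 18; 21; 24; 26; 27; 28]%N) || (30 <= m)%N ->
     exists s q : nat,
       [/\ (3 <= s)%N, m = (6 * s + q)%N
         & forall (alt : Y1_form) (c : nat -> R[i]) (p : {poly R[i]}),
             (C_Z2qs alt s q c p + 2)%N = C_PS m]).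
Proof.
split=> [alt s q p s_ge3 p_size [c c_stable]|m m_range].
  have s_gt0 : (0 < s)%N by apply: leq_trans s_ge3.
  exists c; split=> // [n A|]; last exact: C_Z2qsE.
  split; last exact: run_Z2qs.
  have pE : Z2qs alt s q c p 'X = p.
    by case: c_stable => c_sol _; apply: Z2qs_solution; rewrite ?p_size.
  by rewrite -[in RHS]pE rmorph_Z2qs /= horner_mx_X.
suff [s [s_ge3 s_le sE]] : exists s,
    [/\ (3 <= s)%N, (6 * s <= m)%N & PS_cost_at m s = C_PS m].
  exists s, (m - 6 * s)%N; split=> //; first by rewrite subnKC.
  move=> alt c p; have s_gt0 : (0 < s)%N by apply: leq_trans s_ge3.
  by rewrite C_Z2qsE// two_saved.
have [m_small|m_ge30] := orP m_range.
  exists (if m <= 21 then 3 else 4)%N; move: m_small.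
  by rewrite !inE => /or4P[| | |/or3P[]] /eqP->.
(* Below 36 the root is 5, and 6 * 5 is still at most m. *)
exists (PeanoNat.Nat.sqrt m); rewrite C_PS_floor; last lia.
have := PeanoNat.Nat.sqrt_spec m (PeanoNat.Nat.le_0_l m).
by move: (PeanoNat.Nat.sqrt m) => k [klo khi]; split=> //; nia.
Qed.
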